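(* Consider colored partitions in which each part $k$ comes in $k$ colors: a such partition of $n$ is a finite multiset of colored parts $r_c$ with $r\ge1$ and $c\in\{1,\dots,r\}$, whose sizes (counted with multiplicity) sum to $n$. Let $F_k(n)$ be the total number of parts of size $k$ (of any color, with multiplicity) appearing in all such partitions of $n$. For such a partition $\pi$, let $g_k(\pi)$ be the number of distinct colored parts $r_c$ occurring at least $k$ times in $\pi$, and let $G_k(n)=\sum_\pi g_k(\pi)$ over all such partitions $\pi$ of $n$, with $G_k(m)=0$ for $m\le 0$. Then for all $n=1,2,\dots$ and $k=1,2,\dots,n$, $$F_k(n)=k\big(G_k(n)-G_k(n-k)\big).$$
   Context: The generating function for the number of such partitions is $\prod_{k\ge1}(1-q^k)^{-k}$. *)

(* Defs.v *)
From mathcomp Require Import all_boot all_order all_algebra.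
From mathcomp Require Import finmap multiset.
From mathcomp Require Import boolp classical_sets functions cardinality.

Set Implicit Arguments.
Unset Strict Implicit.
Unset Printing Implicit Defensive.

Local Open Scope fset_scope.
Local Open Scope nat_scope.

(* The part r_c is [Tagged ordinal c] with [c : 'I_r]: the r colors of a part
   of size r are numbered from 0 to r - 1, and since 'I_0 is empty every part
   has positive size. *)
Definition colored_part : choiceType := {r : nat & 'I_r}.

Definition part_size (x : colored_part) : nat := tag x.

Notation colored_partition := {mset colored_part}%mset.

(* A multiset [pi] coerces to the sequence of its elements, repeated according
   to multiplicity, and [pi x] is the multiplicity of [x]. *)
Definition weight (pi : colored_partition) : nat :=
  \sum_(x <- pi) part_size x.

Definition partitions_of (n : nat) : set colored_partition :=
  [set pi | weight pi = n]%classic.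

(* [fset_set] is the finite set with the same elements when its argument is
   finite, and is empty otherwise; the next lemmas rule out the second case. *)
Lemma finite_partitions_of (n : nat) : finite_set (partitions_of n).
Proof.
pose parts : seq colored_part :=
  flatten [seq [seq Tagged ordinal c | c : 'I_r] | r <- iota 0 n.+1].
have parts_in (x : colored_part) : part_size x <= n -> x \in parts.
  case: x => r c; rewrite /part_size /= => le_rn; apply/flatten_mapP.
  exists r; first by rewrite mem_iota.
  by apply/mapP; exists c; rewrite ?mem_enum.
pose words := fix words (m : nat) : seq (seq colored_part) :=
  if m is m'.+1 then
    [::] :: [seq x :: s | x <- parts, s <- words m'] else [:: [::]].
have words_in m (s : seq colored_part) :
    size s <= m -> all (mem parts) s -> s \in words m.
  elim: m s => [|m IH] [|x s] //= les /andP[xp sp].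
  by rewrite inE; apply/orP; right; apply: allpairs_f => //; exact: IH.
apply: (sub_finite_set (B := [set` [seq seq_mset s : colored_partition
                                     | s <- words n]])); last first.
  exact: finite_seq.
move=> pi /= wpi; apply/mapP; exists (enum_mset pi); last first.
  by rewrite seq_mset_id.
apply: words_in.
  rewrite -wpi /weight -sum1_size; apply: leq_sum => -[[|r] c] _ //.
  by case: c.
apply/allP => x xpi; apply: parts_in.
by rewrite -wpi /weight (big_rem x) //= leq_addr.
Qed.

Lemma in_partitions_of (n : nat) (pi : colored_partition) :
  (pi \in fset_set (partitions_of n)) = (weight pi == n).
Proof.
rewrite in_fset_set; last exact: finite_partitions_of.
by apply/idP/eqP; rewrite inE.
Qed.

Definition parts_of_size (k : nat) (pi : colored_partition) : nat :=
  count (fun x => part_size x == k) pi.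

Definition F (k n : nat) : nat :=
  \sum_(pi <- fset_set (partitions_of n)) parts_of_size k pi.

Definition g (k : nat) (pi : colored_partition) : nat :=
  #|` [fset x in finsupp pi | k <= pi x] |.

Definition G (k : nat) (m : int) : nat :=
  if (0 < m)%R then \sum_(pi <- fset_set (partitions_of `|m|%N)) g k pi else 0.

(* Main.v *)
Require Import Defs.
From mathcomp Require Import all_boot all_order all_algebra.
From mathcomp Require Import finmap multiset.
From mathcomp Require Import cardinality.
From mathcomp Require Import zify.

(** Writing [p m] for the number of colored partitions of [m], removing [j]
    copies of a part of size [s] shows that [p (n - j s)] partitions of [n]
    contain that part at least [j] times.  As there are [r] colors for the
    size [r], this gives [F_k(n) = k (p(n - k) + p(n - 2k) + ...)] and
    [G_k(n) = p(n - k) + 2 p(n - 2k) + 3 p(n - 3k) + ...]; the difference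
    [G_k(n) - G_k(n - k)] telescopes to [p(n - k) + p(n - 2k) + ...]. *)

(* [p (n - m)]; the guard is needed because truncated subtraction would give
   [p 0 = 1] instead of [0] when [n < m]. *)
Definition num_partitions_sub (n m : nat) : nat :=
  if m <= n then #|` fset_set (partitions_of (n - m))| else 0.

Lemma num_partitions_subD (n m l : nat) :
  l <= n -> num_partitions_sub n (l + m) = num_partitions_sub (n - l) m.
Proof.
move=> le_ln; rewrite /num_partitions_sub subnDA.
by have -> : (l + m <= n) = (m <= n - l) by lia.
Qed.

Lemma weight_msetD (pi sigma : colored_partition) :
  weight (pi `+` sigma)%mset = weight pi + weight sigma.
Proof.
rewrite /weight -big_cat; apply: perm_big.
by apply/allP => x _ /=; rewrite count_cat !count_mem_mset msetE2.
Qed.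

Lemma weight_msetn (j : nat) (x : colored_part) :
  weight (msetn j x) = j * part_size x.
Proof. by rewrite /weight enum_msetn big_nseq iter_addn_0 mulnC. Qed.

Lemma leq_mset_weight (x : colored_part) (pi : colored_partition) :
  pi x * part_size x <= weight pi.
Proof.
have sub : (msetn (pi x) x `<=` pi)%mset.
  by apply/msubsetP => y; rewrite msetnE; case: eqP => // ->.
by rewrite -[X in _ <= weight X](msetBDKC sub) weight_msetD weight_msetn leq_addr.
Qed.

Lemma sum_leq_mult (n j : nat) (x : colored_part) :
  \sum_(pi <- fset_set (partitions_of n)) (j <= pi x) =
  num_partitions_sub n (j * part_size x).
Proof.
rewrite -big_mkcond sum1_count -size_filter /num_partitions_sub.
set s := part_size x.
case: leqP => [le_jsn | lt_njs]; last first.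
  apply/eqP; rewrite size_filter -leqn0 leqNgt -has_count; apply/hasPn => pi.
  rewrite in_partitions_of => /eqP wpi; apply: contraL lt_njs => le_jpi.
  rewrite -leqNgt -wpi; apply: leq_trans (leq_mset_weight x pi).
  by rewrite leq_mul2r le_jpi orbT.
(* Adding [j] copies of [x] maps the partitions of [n - j * s] bijectively onto those counted on the
   left; the inverse removes these copies. *)
rewrite -[RHS](size_map (msetD (msetn j x))); apply/perm_size/uniq_perm.
- by rewrite filter_uniq.
- rewrite map_inj_uniq ?fset_uniq //.
  exact: (can_inj (@msetDKB _ _)).
move=> pi; rewrite mem_filter in_partitions_of.
apply/andP/mapP => [[le_jpi /eqP wpi] | [sigma]]; last first.
  rewrite in_partitions_of => /eqP wsigma ->.
  by rewrite msetE2 msetnxx leq_addr weight_msetD weight_msetn wsigma subnKC.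
have sub : (msetn j x `<=` pi)%mset.
  by apply/msubsetP => y; rewrite msetnE; case: eqP => // ->.
exists (pi `\` msetn j x)%mset; last by rewrite msetBDKC.
rewrite in_partitions_of -(eqn_add2l (j * s)) subnKC // -wpi.
by rewrite -[X in _ == weight X](msetBDKC sub) weight_msetD weight_msetn.
Qed.

(** After the sums are exchanged, an element [r_c] of [pi] is counted for exactly one color if
    [r = k] and for none otherwise. *)
Lemma parts_of_sizeE (k : nat) (pi : colored_partition) :
  parts_of_size k pi = \sum_(c < k) pi (Tagged ordinal c).
Proof.
rewrite /parts_of_size -sum1_count big_mkcond /=.
under [RHS]eq_bigr => c _.
  rewrite -count_mem_mset -sum1_count big_mkcond /=; over.
rewrite exchange_big /=; apply: eq_bigr => -[r c] _; rewrite /part_size /=.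
case: eqP => [eq_rk | ne_rk].
  case: k / eq_rk; rewrite (bigD1 c) //= eqxx big1 // => d ne_dc.
  by rewrite eq_Tagged /= eq_sym (negbTE ne_dc).
by rewrite big1 // => d _; case: eqP => // /(congr1 tag).
Qed.

Lemma F_sum (k n : nat) : 0 < k ->
  F k n = k * \sum_(j < n) num_partitions_sub n (k * j.+1).
Proof.
move=> k_gt0; rewrite /F; under eq_bigr do rewrite parts_of_sizeE.
rewrite exchange_big /= -[X in _ = X * _]card_ord -sum_nat_const.
(* A multiplicity is the number of [j] below it; [j < n] suffices, since a part of positive size
   occurs at most [n] times in a partition of [n]. *)
apply: eq_bigr => c _; transitivity (\sum_(j < n)
    \sum_(pi <- fset_set (partitions_of n)) (j < pi (Tagged ordinal c))).
  rewrite exchange_big /= !big_seq; apply: eq_bigr => pi.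
  rewrite in_partitions_of => /eqP wpi.
  have le_pin : pi (Tagged ordinal c) <= n.
    rewrite -wpi; apply: leq_trans (leq_mset_weight (Tagged ordinal c) pi).
    by rewrite leq_pmulr.
  by rewrite -big_mkcond /= (big_ord_narrow le_pin) sum1_card card_ord.
by apply: eq_bigr => j _; rewrite sum_leq_mult mulnC.
Qed.

(** A part of size at least [N] outweighs [pi], hence is absent, and since [k > 0] absent parts are
    never counted. The range thus depends only on a bound for the weight, so the sum over [pi] can
    be moved inside. *)
Lemma g_sum (k N : nat) (pi : colored_partition) :
  0 < k -> weight pi < N ->
  g k pi = \sum_(r < N) \sum_(c < r) (k <= pi (Tagged ordinal c)).
Proof.
move=> k_gt0 lt_piN; rewrite /g.
pose parts : seq colored_part :=
  [seq Tagged ordinal c | r <- index_iota 0 N, c <- index_enum 'I_r].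
transitivity (\sum_(x <- parts) (k <= pi x)); last first.
  by rewrite big_allpairs_dep /= big_mkord.
rewrite -big_mkcond sum1_count -size_filter.
apply/perm_size/uniq_perm => [||[r c]]; first exact: fset_uniq.
  rewrite filter_uniq // allpairs_uniq_dep ?iota_uniq //.
    by move=> r _; rewrite index_enum_uniq.
  by move=> [r c] [r' c'] _ _ /=.
rewrite mem_filter !inE /= andbC msuppE in_mset.
apply: andb_id2l => le_kpi; rewrite (leq_trans k_gt0 le_kpi); apply/esym.
apply/allpairsPdep; exists r, c; split; rewrite ?mem_index_enum //.
rewrite mem_index_iota (leq_ltn_trans _ lt_piN) //.
apply: leq_trans (leq_mset_weight (Tagged ordinal c) pi).
by rewrite leq_pmull // (leq_trans k_gt0).
Qed.

Lemma sum_g (k n N : nat) : 0 < k -> n < N ->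
  \sum_(pi <- fset_set (partitions_of n)) g k pi =
  \sum_(r < N) r * num_partitions_sub n (k * r).
Proof.
move=> k_gt0 lt_nN; rewrite big_seq.
under eq_bigr => pi.
  rewrite in_partitions_of => /eqP wpi.
  rewrite (g_sum _ N) ?wpi //; over.
rewrite -big_seq exchange_big; apply: eq_bigr => r _ /=.
rewrite exchange_big -[X in _ = X * _]card_ord -sum_nat_const.
by apply: eq_bigr => c _; rewrite sum_leq_mult.
Qed.

Lemma G_sum (k n N : nat) : 0 < k -> n < N ->
  G k n%:Z = \sum_(r < N) r * num_partitions_sub n (k * r).
Proof.
move=> k_gt0 lt_nN; rewrite /G -sum_g //; case: n lt_nN => [|n] _ //=.
(* For [n = 0] the guard in [G] gives 0; so does the sum over partitions, as the cutoff 1 leaves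
   only the term [r = 0]. *)
rewrite (sum_g _ _ 1) // big_ord_recl big_ord0 /=; lia.
Qed.

Theorem theorem6 (n k : nat) (hk : (1 <= k <= n)%N) :
  ((F k n)%:Z = k%:Z * ((G k n%:Z)%:Z - (G k (n%:Z - k%:Z))%:Z))%R.
Proof.
have /andP[k_gt0 le_kn] := hk.
rewrite (subzn le_kn) F_sum // (G_sum _ _ n.+1) // (G_sum _ (n - k) n) //; last lia.
(* The term [r = 0] vanishes. In the others, one of the [r + 1] copies of [p(n - k(r + 1))] goes to
   the first sum and [r] go to the second; the cutoffs [n.+1] and [n] match this shift. *)
have -> : \sum_(r < n.+1) r * num_partitions_sub n (k * r) =
    \sum_(j < n) num_partitions_sub n (k * j.+1) +
    \sum_(r < n) r * num_partitions_sub (n - k) (k * r).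
  rewrite big_ord_recl mul0n add0n -big_split; apply: eq_bigr => r _ /=.
  by rewrite /bump /= add1n mulSn -(num_partitions_subD _ _ _ le_kn) -mulnS.
by rewrite PoszD GRing.addrK PoszM.
Qed.
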